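(* Let $X$ be a Banach space with the Daugavet property. For a closed linear subspace $Z\subset X$ the following conditions are equivalent: (i) $Z$ is poor. (ii) $X/\tilde Z$ has the Daugavet property for every closed linear subspace $\tilde Z\subset Z$ of codimension $\operatorname{codim}_Z\tilde Z\le 2$ in $Z$. (iii) $Z^{\bot}$ is a subspace of $X^*$ that is rich with respect to $X$. (iv) For every $x^*,e^*\in S_{X^*}$, every $\varepsilon>0$ and every $x\in S_X$ such that $e^*(x)>1-\varepsilon$ there is an element $v^*\in B_{X^*}$ such that $v^*(x)>1-\varepsilon$, $\|x^*+v^*\|>2-\varepsilon$ and $\|(e^*-v^* )|_Z\|<\varepsilon$ (that is, the quotient map from $X^*$ onto $X^*/Z^{\bot}$ is narrow with respect to $X$).
   Context: All Banach spaces are real; $B_X$, $S_X$ denote the closed unit ball and unit sphere. $X$ has the Daugavet property if $\|\mathrm{Id}+T\|=1+\|T\|$ for every rank-one bounded linear operator $T\colon X\to X$. If $X$ has the Daugavet property, a closed linear subspace $Z\subset X$ is poor if $X/\tilde Z$ has the Daugavet property for every closed linear subspace $\tilde Z\subset Z$. $Z^\bot=\{x^*\in X^*: x^*|_Z=0\}$. A linear subspace $Y\subset W^*$ is norming (for a Banach space $W$) if $\|w\|=\sup\{|y^*(w)|: y^*\in Y,\ \|y^*\|\le 1\}$ for all $w\in W$. $W$ has the Daugavet property with respect to $Y$, written $W\in \mathrm{DPr}(Y)$, if $\|\mathrm{Id}+T\|=1+\|T\|$ for every operator $T\colon W\to W$ of the form $T=y^*\otimes w_0$, i.e. $Tw=y^*(w)w_0$,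 with $w_0\in W$, $y^*\in Y$. For $W\in \mathrm{DPr}(Y)$, a bounded linear operator $T\colon W\to E$ into a Banach space $E$ is narrow with respect to $Y$ ($Y$-narrow) if for every $x,e\in S_W$, every $\varepsilon>0$ and every slice $S=\{w\in B_W: y^*(w)>1-\delta\}$ (with $y^*\in Y$, $\|y^*\|=1$, $\delta>0$) containing $e$ there is $v\in S$ with $\|x+v\|>2-\varepsilon$ and $\|Tv-Te\|<\varepsilon$. A closed linear subspace $V\subset W$ is rich with respect to $Y$ if the quotient map $q\colon W\to W/V$ is $Y$-narrow. In (iii) and (iv) these notions are applied with $W=X^*$ and $Y=X$, regarded as a norming subspace of $X^{**}$ via the canonical embedding (if $X$ has the Daugavet property then $X^*\in\mathrm{DPr}(X)$). *)

(* Defs.v *)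
From HB Require Import structures.
From mathcomp Require Import all_boot all_order all_algebra.
From mathcomp Require Import generic_quotient ring_quotient.
From mathcomp Require Import all_classical all_reals.
From mathcomp Require Import topology normedtype sequences.

Set Implicit Arguments.
Unset Strict Implicit.
Unset Printing Implicit Defensive.

Import Order.TTheory GRing.Theory Num.Theory.
Import numFieldNormedType.Exports.

Local Open Scope classical_set_scope.
Local Open Scope ring_scope.

Section OperatorNorm.
Variables (R : realType) (V W : normedModType R).
Implicit Types (A : set V) (f g : V -> W).

(* The norm of the restriction of [f] to the subspace [A]; as [sup] of an
   unbounded set is 0, it is meaningful for bounded operators only. *)
Definition opnorm_on A f : R :=
  sup [set `|f x| | x in A `&` [set x | `|x| <= 1]].

Definition opnorm f : R := opnorm_on setT f.

Lemma opnorm_has_sup (f : {linear V -> W}) : continuous f ->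
  has_sup [set `|f x| | x in setT `&` [set x : V | `|x| <= 1]].
Proof.
move=> /linear_bounded_continuous /bounded_funP /(_ 1)[M fM]; split.
  by exists `|f 0|, 0 => //; split => //=; rewrite normr0 ler01.
by exists M => _ [x [_ /= x1] <-]; exact: fM.
Qed.

Lemma opnorm_ge0 f : 0 <= opnorm f.
Proof.
have [fs|/sup_out fs] := pselect (has_sup
  [set `|f x| | x in setT `&` [set x : V | `|x| <= 1]]); last first.
  by rewrite /opnorm /opnorm_on fs.
apply: (le_trans (normr_ge0 (f 0))); apply: sup_upper_bound => //.
by exists 0 => //; split => //=; rewrite normr0 ler01.
Qed.

Lemma opnorm_le (f : {linear V -> W}) x : continuous f ->
  `|f x| <= opnorm f * `|x|.
Proof.
move=> fc; have [->|x0] := eqVneq x 0; first by rewrite linear0 !normr0 mulr0.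
have nx0 : 0 < `|x| by rewrite normr_gt0.
have fE : `|f x| = `|f (`|x|^-1 *: x)| * `|x|.
  by rewrite linearZ/= normrZ ger0_norm ?invr_ge0// mulrAC mulVf ?mul1r ?gt_eqF.
rewrite fE ler_wpM2r//; apply: sup_upper_bound; first exact: opnorm_has_sup.
exists (`|x|^-1 *: x) => //; split => //=.
by rewrite normrZ ger0_norm ?invr_ge0// mulVf ?gt_eqF.
Qed.

Lemma opnorm_leP f (M : R) : 0 <= M ->
  (forall x, `|f x| <= M * `|x|) -> opnorm f <= M.
Proof.
move=> M0 fM; apply: ge_sup.
  by exists `|f 0|, 0 => //; split => //=; rewrite normr0 ler01.
move=> _ [x [_ /= x1] <-]; apply: le_trans (fM x) _.
by rewrite ler_piMr.
Qed.

Lemma bounded_continuous (f : {linear V -> W}) (M : R) :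
  (forall x, `|f x| <= M * `|x|) -> continuous f.
Proof.
move=> fM; apply: bounded_linear_continuous; apply/linear_boundedP.
near=> r => x; apply: le_trans (fM x) _; rewrite ler_wpM2r//.
by near: r; apply: nbhs_pinfty_ge; rewrite num_real.
Unshelve. all: by end_near. Qed.

End OperatorNorm.

Section Dual.
Variables (R : realType) (X : normedModType R).

Definition dual_pred : {pred X -> R^o} :=
  [pred f | `[< linear f /\ continuous f >]].

Lemma dual_submod_closed : submod_closed dual_pred.
Proof.
split.
  apply/asboolP; split; last exact: cst_continuous.
  by move=> a u v; rewrite -[RHS]/(a *: (0 : R^o) + 0) scaler0 addr0.
move=> a f g /asboolP[fl fc] /asboolP[gl gc]; apply/asboolP; split.
  move=> b u v; rewrite -[LHS]/(a *: f (b *: u + v) + g (b *: u + v)).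
  rewrite -[RHS]/(b *: (a *: f u + g u) + (a *: f v + g v)) fl gl.
  by rewrite !scalerDr !scalerA (mulrC a) addrACA.
move=> x; apply: (@cvgD _ R^o); last exact: gc.
by apply: cvgZl_tmp; exact: fc.
Qed.

HB.instance Definition _ :=
  GRing.isSubmodClosed.Build R (X -> R^o) dual_pred dual_submod_closed.

Record dual := Dual { dual_fun :> X -> R^o ; dual_funP : dual_fun \in dual_pred }.

HB.instance Definition _ := [isSub for dual_fun].
HB.instance Definition _ := [Choice of dual by <:].
HB.instance Definition _ := [SubChoice_isSubLmodule of dual by <:].

Lemma dual_linear (f : dual) : linear f.
Proof. by have /asboolP[] := dual_funP f. Qed.

HB.instance Definition _ (f : dual) :=
  GRing.isLinear.Build R X R^o *:%R f (@dual_linear f).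

Lemma dual_continuous (f : dual) : continuous f.
Proof. by have /asboolP[] := dual_funP f. Qed.

Lemma dual_normD (f g : dual) : opnorm (f + g) <= opnorm f + opnorm g.
Proof.
apply: opnorm_leP; first by rewrite addr_ge0// opnorm_ge0.
move=> x; rewrite (le_trans (ler_normD _ _))// mulrDl lerD// opnorm_le//;
  exact: dual_continuous.
Qed.

Lemma dual_normZ (a : R) (f : dual) : opnorm (a *: f) = `|a| * opnorm f.
Proof.
have le b (g : dual) : opnorm (b *: g) <= `|b| * opnorm g.
  apply: opnorm_leP; first by rewrite mulr_ge0// opnorm_ge0.
  move=> x; rewrite -[X in `|X|]/(b *: g x) normrZ -mulrA ler_wpM2l// opnorm_le//.
  exact: dual_continuous.
apply/eqP; rewrite eq_le le/=; have [->|a0] := eqVneq a 0.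
  by rewrite normr0 mul0r opnorm_ge0.
rewrite -ler_pdivlMl ?normr_gt0// -normfV.
by have := le a^-1 (a *: f); rewrite scalerA mulVf// scale1r.
Qed.

Lemma dual_norm_eq0 (f : dual) : opnorm f = 0 -> f = 0.
Proof.
move=> f0; apply/val_inj/funext => x; apply/eqP; rewrite -normr_le0.
by rewrite (le_trans (opnorm_le x (@dual_continuous f)))// f0 mul0r.
Qed.

HB.instance Definition _ :=
  Lmodule_isNormed.Build R dual dual_normD dual_normZ dual_norm_eq0.

Lemma dual_normE (f : dual) : `|f| = opnorm f.
Proof. by []. Qed.

Lemma dual_norm_le (f : dual) x : `|f x| <= `|f| * `|x|.
Proof. by apply: opnorm_le; exact: dual_continuous. Qed.

Lemma dual_complete (F : set_system dual) :
  ProperFilter F -> cauchy F -> cvg F.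
Proof.
move=> FF /(cauchyP F) Fc.
have evc x : cvg ((fun f : dual => f x) @ F).
  apply: (@cauchy_cvg R^o); apply: cauchy_exP => e e0.
  have x1 : 0 < `|x| + 1 by rewrite ltr_wpDl.
  have [g Fg] := Fc _ (divr_gt0 e0 x1); exists (g x).
  rewrite /fmap/=; apply: filterS Fg => f.
  rewrite -!ball_normE /=. rewrite ltr_pdivlMr// => gf.
  rewrite -[X in `|X|]/((g - f) x) (le_lt_trans (dual_norm_le _ _))//.
  by rewrite (le_lt_trans _ gf)// ler_wpM2l// lerDl.
pose l x : R^o := lim ((fun f : dual => f x) @ F).
have lP x : (fun f : dual => f x) @ F --> l x by exact: evc.
have ll : linear l.
  move=> a u v.
  have s : (fun f : dual => a *: f u + f v) @ F --> a *: l u + l v.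
    by apply: cvgD; [apply: cvgZl_tmp; exact: lP|exact: lP].
  apply: (cvg_unique _ (lP _)) => //; apply: cvg_trans s.
  by apply: near_eq_cvg; apply: nearW => f; rewrite (dual_linear f).
have lg e (g : dual) : 0 < e -> F (ball g e) ->
    forall x, `|l x - g x| <= e * `|x|.
  move=> e0 Fg x.
  have : (fun f : dual => `|f x - g x|) @ F --> `|l x - g x|.
    by apply: cvg_norm; apply: cvgB; [exact: lP|exact: cvg_cst].
  move=> /cvg_lim <-//; apply: limr_le.
    apply: is_cvg_norm; apply: is_cvgB; [exact: evc|exact: is_cvg_cst].
  apply: filterS Fg => f; rewrite -ball_normE /= => gf.
  rewrite distrC -[X in `|X|]/((g - f) x) (le_trans (dual_norm_le _ _))//.
  by rewrite ler_wpM2r// ltW.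
have lc : continuous l.
  pose L := GRing.isLinear.Build R X R^o *:%R l ll.
  pose l' : {linear X -> R^o} := HB.pack l L.
  have [g Fg] := Fc _ ltr01.
  apply: (@bounded_continuous _ _ _ l' (1 + `|g|)) => x.
  rewrite -[l' x](subrK (g x)) (le_trans (ler_normD _ _))// mulrDl lerD//.
    exact: lg.
  exact: dual_norm_le.
have lD : l \in dual_pred by apply/asboolP.
apply/cvg_ex; exists (Dual lD); apply/cvgrPdist_le => e e0.
have e2 : 0 < e / 2 by rewrite divr_gt0.
have [g Fg] := Fc _ e2.
apply: filterS (Fg) => f; rewrite -ball_normE /= => gf.
rewrite (le_trans (ler_distD g _ _))// (splitr e) lerD//; last exact: ltW.
by apply: opnorm_leP => [|x]; [exact: ltW|exact: lg].
Qed.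

HB.instance Definition _ := Uniform_isComplete.Build dual dual_complete.

End Dual.

Section ClosedSubspace.
Variables (R : realType) (X : normedModType R).

Record closedSubspace := ClosedSubspace {
  csub_set :> set X ;
  csub_submod : submod_closed (mem csub_set) ;
  csub_closed : closed csub_set }.

Definition csub_pred (Z : closedSubspace) : {pred X} := mem (csub_set Z).

HB.instance Definition _ (Z : closedSubspace) :=
  GRing.isSubmodClosed.Build R X (csub_pred Z) (csub_submod Z).

Lemma csub_predP (Z : closedSubspace) x : reflect (csub_set Z x) (x \in csub_pred Z).
Proof. by apply: (iffP idP) => [/set_mem|/mem_set]. Qed.

End ClosedSubspace.

Section Quotient.
Variables (R : realType) (X : normedModType R) (Z : closedSubspace X).

Local Open Scope quotient_scope.

Definition quotient_space := Quotient.quot (csub_pred Z).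

HB.instance Definition _ := GRing.Zmodule.on quotient_space.

Definition quotient_map (x : X) : quotient_space := \pi_quotient_space x.

Lemma quotient_mapK (q : quotient_space) : quotient_map (repr q) = q.
Proof. exact: reprK. Qed.

Lemma quotient_mapD x y :
  quotient_map (x + y) = quotient_map x + quotient_map y.
Proof. by rewrite /quotient_map !piE. Qed.

Lemma quotient_map_eq x y :
  quotient_map x = quotient_map y <-> csub_set Z (x - y).
Proof.
split => [xy|Zxy].
  by apply/csub_predP; rewrite Quotient.idealrBE; apply/eqP.
by apply/eqP; rewrite -Quotient.idealrBE; apply/csub_predP.
Qed.

Definition quotient_scale (a : R) (q : quotient_space) : quotient_space :=
  quotient_map (a *: repr q).

Lemma quotient_scaleE a x :
  quotient_scale a (quotient_map x) = quotient_map (a *: x).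
Proof.
apply/quotient_map_eq; rewrite -scalerBr; apply/csub_predP/rpredZ/csub_predP.
by apply/quotient_map_eq; rewrite quotient_mapK.
Qed.

Lemma quotient_scaleA a b q :
  quotient_scale a (quotient_scale b q) = quotient_scale (a * b) q.
Proof. by rewrite -[q]quotient_mapK !quotient_scaleE scalerA. Qed.

Lemma quotient_scale1 : left_id 1 quotient_scale.
Proof. by move=> q; rewrite -[q]quotient_mapK quotient_scaleE scale1r. Qed.

Lemma quotient_scaleDr : right_distributive quotient_scale +%R.
Proof.
move=> a q r; rewrite -[q]quotient_mapK -[r]quotient_mapK -quotient_mapD.
by rewrite !quotient_scaleE scalerDr quotient_mapD.
Qed.

Lemma quotient_scaleDl q :
  {morph quotient_scale^~ q : a b / a + b}.
Proof.
move=> a b; rewrite -[q]quotient_mapK !quotient_scaleE scalerDl.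
exact: quotient_mapD.
Qed.

HB.instance Definition _ := GRing.Zmodule_isLmodule.Build R quotient_space
  quotient_scaleA quotient_scale1 quotient_scaleDr quotient_scaleDl.

Lemma quotient_map_linear : linear quotient_map.
Proof. by move=> a x y; rewrite quotient_mapD -quotient_scaleE. Qed.

HB.instance Definition _ :=
  GRing.isLinear.Build R X quotient_space *:%R quotient_map quotient_map_linear.

Definition quotient_norm (q : quotient_space) : R :=
  inf [set `|x| | x in [set x | quotient_map x = q]].

Lemma quotient_norm_has_inf q :
  has_inf [set `|x| | x in [set x | quotient_map x = q]].
Proof.
split; first by exists `|repr q|, (repr q) => //=; rewrite quotient_mapK.
by exists 0 => _ [x _ <-].
Qed.

Lemma quotient_norm_le x : quotient_norm (quotient_map x) <= `|x|.
Proof. by apply: ge_inf; [exact: (quotient_norm_has_inf _).2|exists x]. Qed.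

Lemma quotient_norm_ge0 q : 0 <= quotient_norm q.
Proof.
by apply: lb_le_inf => [|_ [x _ <-]//]; exact: (quotient_norm_has_inf _).1.
Qed.

Lemma quotient_norm_lift q (e : R) : quotient_norm q < e ->
  exists2 x, quotient_map x = q & `|x| < e.
Proof.
rewrite -subr_gt0 => /inf_adherent/(_ (quotient_norm_has_inf q)).
by move=> [_ [x /= xq <-]]; rewrite addrC subrK; exists x.
Qed.

Lemma quotient_normD q r :
  quotient_norm (q + r) <= quotient_norm q + quotient_norm r.
Proof.
apply/ler_addgt0Pr => e e0.
have lt t : quotient_norm t < quotient_norm t + e / 2 by rewrite ltrDl divr_gt0.
have [x xq xe] := quotient_norm_lift (lt q).
have [y yr ye] := quotient_norm_lift (lt r).
rewrite -[in leLHS]xq -[in leLHS]yr -quotient_mapD.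
rewrite (le_trans (quotient_norm_le _))// (le_trans (ler_normD _ _))//.
by rewrite (splitr e) addrACA lerD// ltW.
Qed.

Lemma quotient_normZ a q : quotient_norm (a *: q) = `|a| * quotient_norm q.
Proof.
have le b r : quotient_norm (b *: r) <= `|b| * quotient_norm r.
  have [->|b0] := eqVneq b 0.
    rewrite scale0r normr0 mul0r -(linear0 quotient_map).
    by rewrite (le_trans (quotient_norm_le _))// normr0.
  rewrite -ler_pdivrMl ?normr_gt0//; apply/ler_addgt0Pr => e e0.
  have lt : quotient_norm r < quotient_norm r + e by rewrite ltrDl.
  have [x xr /ltW xe] := quotient_norm_lift lt.
  rewrite (le_trans _ xe)// ler_pdivrMl ?normr_gt0// -normrZ -xr.
  by rewrite -(linearZ_LR quotient_map); exact: quotient_norm_le.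
apply/eqP; rewrite eq_le le/=; have [->|a0] := eqVneq a 0.
  by rewrite normr0 mul0r quotient_norm_ge0.
rewrite -ler_pdivlMl ?normr_gt0// -normfV.
by have := le a^-1 (a *: q); rewrite scalerA mulVf// scale1r.
Qed.

Lemma quotient_norm_eq0 q : quotient_norm q = 0 -> q = 0.
Proof.
move=> q0; rewrite -[q]quotient_mapK -(linear0 quotient_map).
apply/quotient_map_eq; rewrite subr0; apply: csub_closed => B.
move=> /nbhs_ballP[e /= e0 eB].
have [x xq xe] : exists2 x, quotient_map x = q & `|x| < e.
  by apply: quotient_norm_lift; rewrite q0.
exists (repr q - x); split.
  by apply/quotient_map_eq; rewrite quotient_mapK.
by apply: eB; rewrite -ball_normE /= opprB addrC subrK.
Qed.

HB.instance Definition _ := Lmodule_isNormed.Build R quotient_space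
  quotient_normD quotient_normZ quotient_norm_eq0.

Lemma quotient_normE q : `|q| = quotient_norm q.
Proof. by []. Qed.

Lemma quotient_map_continuous : continuous quotient_map.
Proof.
apply: (@bounded_continuous _ _ _ quotient_map 1) => x; rewrite mul1r.
exact: quotient_norm_le.
Qed.

End Quotient.

Section QuotientComplete.
Variables (R : realType) (X : completeNormedModType R) (Z : closedSubspace X).

Lemma quotient_complete (F : set_system (quotient_space Z)) :
  ProperFilter F -> cauchy F -> cvg F.
Proof.
move=> FF /(cauchyP F) Fc.
have half1 : `|2^-1 : R| < 1.
  by rewrite gtr0_norm ?invr_gt0 ?invf_lt1 ?ltr1n.
have r0 n : 0 < (2^-1 : R) ^+ n by rewrite exprn_gt0 ?invr_gt0.
have /choice[g Fg] n : exists g, F (ball g (2^-1 ^+ n)) by exact: Fc.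
have gS n : `|g n.+1 - g n| < geometric 2 (2^-1) n.
  have [h [hn hn1]] := filter_ex (filterI (Fg n) (Fg n.+1)).
  move: hn hn1; rewrite -!ball_normE /= => hn hn1.
  rewrite (le_lt_trans (ler_distD h _ _))// mulrC mulr_natr mulr2n ltrD//.
    by rewrite (lt_le_trans hn1)// exprS ler_piMl ?ltW// invf_lt1// ltr1n.
  by rewrite distrC.
have /choice[d dP] n : exists d,
    quotient_map Z d = g n.+1 - g n /\ `|d| < geometric 2 (2^-1) n.
  by have [d dg dn] := quotient_norm_lift (gS n); exists d.
have sc : cvgn (series d).
  apply: normed_cvg; apply: (series_le_cvg _ _ _
    (@is_cvg_geometric_series R 2 (2^-1) _)).
  - by move=> n; exact: normr_ge0.
  - by move=> n; rewrite /= mulr_ge0// ltW.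
  - by move=> n; apply/ltW; exact: (dP n).2.
  - exact: half1.
pose x := repr (g 0) + limn (series d).
have qs n : quotient_map Z (repr (g 0) + series d n) = g n.
  elim: n => [|n IH]; first by rewrite /series/= big_geq// addr0 quotient_mapK.
  rewrite seriesSr addrA quotient_mapD IH (dP n).1.
  by rewrite addrC subrK.
have gx : g n @[n --> \oo] --> quotient_map Z x.
  rewrite (_ : g = fun n => quotient_map Z (repr (g 0) + series d n)).
    apply: (@cvg_comp _ _ _ (fun n => repr (g 0) + series d n)); last first.
      exact: quotient_map_continuous.
    by apply: cvgD; [exact: cvg_cst|exact: sc].
  by apply/funext => n; rewrite qs.
apply/cvg_ex; exists (quotient_map Z x); apply/cvgrPdist_lt => e e0.
have e2 : 0 < e / 2 by rewrite divr_gt0.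
have gn : \forall n \near \oo, `|quotient_map Z x - g n| < e / 2.
  by move/cvgrPdist_lt : gx; exact.
have pn : \forall n \near \oo, (2^-1 : R) ^+ n < e / 2.
  have : (fun n => (2^-1 : R) ^+ n) @ \oo --> 0.
    exact: cvg_expr.
  move=> /cvgrPdist_lt/(_ _ e2); apply: filterS => n.
  by rewrite sub0r normrN ger0_norm// ltW.
have [n [gxn en]] := filter_ex (filterI gn pn).
apply: filterS (Fg n) => f; rewrite -ball_normE /= => gf.
by rewrite (le_lt_trans (ler_distD (g n) _ _))// (splitr e) ltrD// (lt_trans gf).
Qed.

HB.instance Definition _ :=
  Uniform_isComplete.Build (quotient_space Z) quotient_complete.

End QuotientComplete.

Section Annihilator.
Variables (R : realType) (X : normedModType R).

Definition annihilator_set (Z : set X) : set (dual X) :=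
  [set f : dual X | forall z, Z z -> f z = 0].

Lemma annihilator_submod (Z : set X) :
  submod_closed (mem (annihilator_set Z)).
Proof.
split=> [|a f g /set_mem fZ /set_mem gZ]; apply/mem_set => z Zz //=.
rewrite -[LHS]/(a *: f z + g z).
by rewrite fZ// gZ// scaler0 addr0.
Qed.

Lemma annihilator_closed (Z : set X) : closed (annihilator_set Z).
Proof.
move=> f clf z Zz; apply/eqP; rewrite -normr_le0; apply/ler_addgt0Pr => e e0.
have z1 : 0 < `|z| + 1 by rewrite ltr_wpDl.
have [g [gZ]] := clf _ (nbhsx_ballx f _ (divr_gt0 e0 z1)).
rewrite -ball_normE /= ltr_pdivlMr// => fg; rewrite add0r.
rewrite -[f z](subr0) -(gZ z Zz) -[X in `|X|]/((f - g) z).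
rewrite (le_trans (dual_norm_le _ _))// (le_trans _ (ltW fg))//.
by rewrite ler_wpM2l// lerDl.
Qed.

Definition annihilator (Z : set X) : closedSubspace (dual X) :=
  ClosedSubspace (@annihilator_submod Z) (@annihilator_closed Z).

End Annihilator.

Section CanonicalEmbedding.
Variables (R : realType) (X : normedModType R).

Lemma canonical_subproof (x : X) :
  (fun f : dual X => f x) \in @dual_pred R (dual X).
Proof.
have l : linear (fun f : dual X => f x) by [].
apply/asboolP; split => //.
pose L := GRing.isLinear.Build R (dual X) R^o *:%R _ l.
pose l' : {linear dual X -> R^o} := HB.pack (fun f : dual X => f x) L.
apply: (@bounded_continuous _ _ _ l' `|x|) => f; rewrite mulrC.
exact: dual_norm_le.
Qed.

Definition canonical_embedding (x : X) : dual (dual X) :=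
  Dual (canonical_subproof x).

End CanonicalEmbedding.

Definition rank_one (R : realType) (V W : lmodType R) (T : V -> W) : Prop :=
  exists2 w : W, w != 0 & range T = [set a *: w | a in [set: R]].

Definition Daugavet (R : realType) (X : completeNormedModType R) : Prop :=
  forall T : {linear X -> X}, continuous T -> rank_one T ->
    opnorm (idfun \+ T) = 1 + opnorm T.

Definition poor (R : realType) (X : completeNormedModType R)
    (Z : closedSubspace X) : Prop :=
  forall Z' : closedSubspace X, Z' `<=` Z -> Daugavet (quotient_space Z').

(* For [Z'] included in [Z]: [Z / Z'] is spanned by the classes of [n]
   vectors of [Z]. *)
Definition codim_le (R : realType) (X : lmodType R) (Z' Z : set X) (n : nat) :
    Prop :=
  exists u : 'I_n -> X, (forall i, Z (u i)) /\
    forall z, Z z -> exists a : 'I_n -> R, Z' (z - \sum_(i < n) a i *: u i).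

Definition slice (R : realType) (W : normedModType R) (y : dual W)
    (delta : R) : set W :=
  [set w | `|w| <= 1 /\ 1 - delta < y w].

(* [Y] stands for a norming subspace of the dual of [W] such that [W] has the
   Daugavet property with respect to [Y]; neither is built in. *)
Definition narrow (R : realType) (W E : completeNormedModType R)
    (Y : set (dual W)) (T : {linear W -> E}) : Prop :=
  continuous T /\
  forall (x e : W) (eps : R) (y : dual W) (delta : R),
    `|x| = 1 -> `|e| = 1 -> 0 < eps -> Y y -> `|y| = 1 -> 0 < delta ->
    slice y delta e ->
    exists v : W, [/\ slice y delta v, 2 - eps < `|x + v| & `|T v - T e| < eps].

Definition rich (R : realType) (W : completeNormedModType R)
    (Y : set (dual W)) (V : closedSubspace W) : Prop :=
  narrow Y (@quotient_map R W V).

(* Main.v *)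
From HB Require Import structures.
Require Import Defs.
From mathcomp Require Import all_boot all_order all_algebra.
From mathcomp Require Import all_classical all_reals.
From mathcomp Require Import topology normedtype.
From mathcomp Require Import ring lra.

Set Implicit Arguments.
Unset Strict Implicit.
Unset Printing Implicit Defensive.

Import Order.TTheory GRing.Theory Num.Theory.
Import numFieldNormedType.Exports.

Local Open Scope classical_set_scope.
Local Open Scope ring_scope.

(** The dual side of the Daugavet property carries the whole proof: if [W] has
the property then, for every nonzero functional [f] and every vector [y],
there is [v] in the dual unit ball with [v y] close to [`|y|] and [`|f + v|]
close to [`|f| + 1]; in other words such [v] exist in every weak-star slice of
the dual ball ([Daugavet_dual]).  The case of norm-one [f] and [y] already
gives the property back ([Daugavet_of_dual]).  The dual of [X / Z'] is,
isometrically, the annihilator of [Z'] ([dual_lift], [dual_pullback_norm]).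

Why codimension two is enough ([rich_annihilator]): given [x'] and [e'], let
[Z'] be the set of the elements of [Z] killed by both.  Both functionals live
on [W = X / Z'], and [Z / Z'] is spanned by two vectors.  So a functional on
[W] close to [e'] at two vectors of [Z] is close to [e'] in norm on [Z], and
one more vector takes care of the given slice.  What is needed is that the
[v] with [`|x' + v|] close to 2 approximate [e'] at finitely many vectors, not
only in a slice.  This is [Daugavet_weak_star_approximation].  The usual
argument replaces a weak-star open set by a convex combination of slices and
appeals to extreme points.  Here a game replaces it, as in the approachability
theorem of Blackwell: choose [v_1], [v_2], ... in the dual ball one at a time,
each time in a slice that pushes the accumulated error back towards 0, and
such that [`|x' + v_1 + ... + v_m|] stays close to [1 + m].  The inner
product of each new error with the accumulated one is at most slightly
positive, so that the latter grows at most like the square root of [m], and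
the mean of the [v_i] has the wanted properties.

From richness to (iv) only the easy estimate is used: the norm on [Z] is at
most the norm modulo the annihilator ([opnorm_on_le_annihilator]).

From (iv) to poorness ([Daugavet_quotient]): for [Z'] included in [Z] and
[e'] vanishing on [Z'], the [v'] of (iv) is small on [Z'].  Subtracting a small
extension of its restriction to [Z'] gives a functional on [X / Z'] as required
by the dual form of the Daugavet property.

The Hahn-Banach theorem enters through norming functionals and through
extensions.  Both follow from one version of it, for convex cones of pairs
(vector, lower bound), [Hahn_Banach_cone]. *)

(** * The Hahn-Banach theorem for sublinear functionals *)

Section HahnBanach.
Variables (R : realType) (V : lmodType R).
Implicit Types (p q : V -> R) (C : V -> R -> Prop).

Definition sublinear p :=
  (forall x y, p (x + y) <= p x + p y) /\
  (forall t x, 0 <= t -> p (t *: x) <= t * p x).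

(** A pair [(z, c)] of the cone stands for the requirement [c <= g z] on the
functional [g] to be found.  With [c] a function of [z] this covers a ray with
a prescribed value as well as the graph of a functional on a subspace. *)
Definition convex_cone C :=
  [/\ C 0 0,
      forall x y a b, C x a -> C y b -> C (x + y) (a + b) &
      forall t x a, 0 <= t -> C x a -> C (t *: x) (t * a)].

Lemma convex_cone_ray (y : V) (b : R) :
  convex_cone (fun z c => exists t, [/\ 0 <= t, z = t *: y & c = t * b]).
Proof.
split; first by exists 0; rewrite scale0r mul0r.
  move=> _ _ _ _ [s [s0 -> ->]] [t [t0 -> ->]]; exists (s + t).
  by rewrite addr_ge0// scalerDl mulrDl.
move=> s _ _ s0 [t [t0 -> ->]]; exists (s * t).
by rewrite mulr_ge0// scalerA mulrA.
Qed.

(** The largest sublinear functional [q] below [p] with [q (- z) <= - c] on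
[C]: a linear functional below it is below [p] and satisfies the requirements
of [C]. *)
Definition inf_convolution p C (x : V) : R :=
  inf [set r | exists z c, C z c /\ r = p (x + z) - c].

Lemma le_inf_add (A B : set R) (c : R) : A !=set0 -> B !=set0 ->
  (forall a b, A a -> B b -> c <= a + b) -> c <= inf A + inf B.
Proof.
move=> A0 B0 cAB; rewrite -lerBlDr; apply: lb_le_inf => // a Aa.
rewrite lerBlDr addrC -lerBlDr; apply: lb_le_inf => // b Bb.
by rewrite lerBlDr addrC cAB.
Qed.

Lemma sublinear0 p : sublinear p -> p 0 = 0.
Proof.
move=> [pD pZ]; apply/eqP; rewrite eq_le; apply/andP; split.
  by rewrite -[X in p X](scale0r 0) (le_trans (pZ _ _ _))// mul0r.
by have := pD 0 0; rewrite addr0 lerDl.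
Qed.

Lemma sublinear_ge p x : sublinear p -> - p (- x) <= p x.
Proof.
move=> sp; have := sp.1 x (- x).
by rewrite subrr (sublinear0 sp) -lerBlDr sub0r.
Qed.

Section InfConvolution.
Variables (p : V -> R) (C : V -> R -> Prop).
Hypotheses (sp : sublinear p) (coneC : convex_cone C).
Hypothesis (Cp : forall z c, C z c -> c <= p z).

Let inf_convolution_le x z c : C z c -> inf_convolution p C x <= p (x + z) - c.
Proof.
move=> Czc; apply: ge_inf; last by exists z, c.
exists (- p (- x)) => _ [y [b [Cyb ->]]].
have := sp.1 (x + y) (- x); rewrite addrAC subrr add0r => pxy.
have := Cp Cyb; lra.
Qed.

Let inf_convolution_nonempty x :
  [set r | exists z c, C z c /\ r = p (x + z) - c] !=set0.
Proof. by have [C0 _ _] := coneC; exists (p (x + 0) - 0), 0, 0. Qed.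

Lemma inf_convolution_le_self x : inf_convolution p C x <= p x.
Proof.
by have [C0 _ _] := coneC; have := inf_convolution_le x C0; rewrite addr0 subr0.
Qed.

Lemma inf_convolution_opp z c : C z c -> inf_convolution p C (- z) <= - c.
Proof.
by move=> /(inf_convolution_le (- z)); rewrite addNr (sublinear0 sp) sub0r.
Qed.

Lemma inf_convolution_sublinear : sublinear (inf_convolution p C).
Proof.
have [C0 CD CZ] := coneC; split=> [x y|t x].
  apply: le_inf_add => // _ _ [z [c [Czc ->]]] [w [d [Cwd ->]]].
  have := inf_convolution_le (x + y) (CD _ _ _ _ Czc Cwd).
  by have := sp.1 (x + z) (y + w); rewrite addrACA; lra.
rewrite le_eqVlt => /predU1P[<-|t0].
  rewrite scale0r mul0r (le_trans (inf_convolution_le_self 0))//.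
  by rewrite (sublinear0 sp).
rewrite -ler_pdivrMl//; apply: lb_le_inf => // _ [z [c [Czc ->]]].
rewrite ler_pdivrMl//.
have := inf_convolution_le (t *: x) (CZ _ _ _ (ltW t0) Czc).
have := sp.2 t (x + z) (ltW t0); rewrite scalerDr; lra.
Qed.

End InfConvolution.

(** Zorn's lemma: on a chain the pointwise infimum is finite, as [p] bounds
it from below by [- p (- x)], and it is subadditive because two members of the
chain can be compared. *)
Lemma minimal_sublinear p : sublinear p ->
  exists q, [/\ sublinear q, forall x, q x <= p x &
    forall r, sublinear r -> (forall x, r x <= q x) -> r = q].
Proof.
move=> sp; pose T := {q : V -> R | sublinear q /\ forall x, q x <= p x}.
pose le (q r : T) := `[< forall x, sval r x <= sval q x >].
have [||||[q [sq qp]] qmin] := @Zorn T le.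
- by move=> q; apply/asboolP.
- move=> q r s /asboolP rq /asboolP sr; apply/asboolP => x.
  exact: le_trans (sr x) (rq x).
- move=> q r /asboolP qr /asboolP rq; apply: eq_sig_hprop => [? ? ?|].
    exact: Prop_irrelevance.
  apply/funext => x.
  by apply/eqP; rewrite eq_le qr rq.
- move=> A chainA; have [[q0 Aq0]|A0] := pselect (A !=set0); last first.
    exists (exist _ p (conj sp (fun x => lexx (p x)))) => s As.
    by exfalso; apply: A0; exists s.
  pose S x := [set sval q x | q in A].
  have S0 x : S x !=set0 by exists (sval q0 x), q0.
  have Sle x (q : T) : A q -> inf (S x) <= sval q x.
    move=> Aq; apply: ge_inf; last by exists q.
    exists (- p (- x)) => _ [[r [sr rp]] _ <-] /=.
    by rewrite (le_trans _ (sublinear_ge x sr))// lerN2.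
  have Ssub : sublinear (fun x => inf (S x)).
    split=> [x y|t x].
      have mono (q : T) : A q -> inf (S (x + y)) <= sval q x + sval q y.
        by move=> Aq; rewrite (le_trans (Sle _ _ Aq))//; apply: (svalP q).1.1.
      apply: le_inf_add => // _ _ [q Aq <-] [r Ar <-].
      have [/asboolP rq|/asboolP qr] := chainA _ _ Aq Ar.
        by rewrite (le_trans (mono _ Ar))// lerD2r.
      by rewrite (le_trans (mono _ Aq))// lerD2l.
    rewrite le_eqVlt => /predU1P[<-|t0].
      rewrite scale0r mul0r (le_trans (Sle _ _ Aq0))//.
      by rewrite (sublinear0 (svalP q0).1).
    rewrite -ler_pdivrMl//; apply: lb_le_inf => // _ [q Aq <-].
    rewrite ler_pdivrMl// (le_trans (Sle _ _ Aq))//.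
    exact: (svalP q).1.2 _ _ (ltW t0).
  have Sp x : inf (S x) <= p x.
    by rewrite (le_trans (Sle _ _ Aq0))//; apply: (svalP q0).2.
  exists (exist _ (fun x => inf (S x)) (conj Ssub Sp) : T) => s As.
  by apply/asboolP => x; exact: Sle.
exists q; split=> // r sr rq.
have rp x : r x <= p x by rewrite (le_trans (rq x)).
by have /(congr1 sval) := qmin (exist _ r (conj sr rp)) (asboolT rq).
Qed.

(** For a vector [y], the infimal convolution of [q] with the ray of the pairs
[(t *: y, t * q y)] is below [q], hence equals [q] by minimality; this yields
[q (- y) <= - q y].  An odd sublinear functional is linear. *)
Lemma minimal_sublinear_linear q : sublinear q ->
  (forall r, sublinear r -> (forall x, r x <= q x) -> r = q) ->
  linear (q : V -> R^o).
Proof.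
move=> sq qmin.
have qN y : q (- y) = - q y.
  pose C z c := exists t, [/\ 0 <= t, z = t *: y & c = t * q y].
  have coneC : convex_cone C by exact: convex_cone_ray.
  have Cq z c : C z c -> c <= q z.
    move=> [t [t0 -> ->]]; move: t0; rewrite le_eqVlt => /predU1P[<-|t0].
      by rewrite scale0r mul0r (sublinear0 sq).
    rewrite -ler_pdivlMl//; have := sq.2 t^-1 (t *: y).
    by rewrite scalerA mulVf ?gt_eqF// scale1r invr_ge0 ltW//; exact.
  have qE := qmin _ (inf_convolution_sublinear sq coneC Cq)
    (inf_convolution_le_self sq coneC Cq).
  apply/eqP; rewrite eq_le; apply/andP; split.
    rewrite -[X in X _ <= _]qE; apply: inf_convolution_opp => //.
    by exists 1; rewrite ler01 scale1r mul1r.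
  by have := sublinear_ge (- y) sq; rewrite opprK.
have qD x y : q (x + y) = q x + q y.
  apply/eqP; rewrite eq_le sq.1/=.
  by have := sq.1 (- x) (- y); rewrite -opprD !qN; lra.
have qZ0 t x : 0 <= t -> q (t *: x) = t * q x.
  move=> t0; apply/eqP; rewrite eq_le sq.2//=.
  by have := sq.2 t (- x) t0; rewrite scalerN !qN; lra.
move=> a x y; rewrite qD; congr (_ + _).
have [a0|/ltW a0] := leP 0 a; first exact: qZ0.
rewrite -[X in q (X *: _)]opprK scaleNr qN qZ0 ?oppr_ge0//.
by rewrite mulNr opprK.
Qed.

(** Any minimal sublinear functional below the infimal convolution of [p] and
[C] will do; for a sublinear functional the requirement [c <= g z] amounts to
[g (- z) <= - c] once it is linear. *)
Lemma Hahn_Banach_cone p C : sublinear p -> convex_cone C ->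
  (forall z c, C z c -> c <= p z) ->
  exists g : V -> R^o, [/\ linear g, forall x, g x <= p x &
    forall z c, C z c -> c <= g z].
Proof.
move=> sp coneC Cp.
have [q [sq qp qmin]] := minimal_sublinear
  (inf_convolution_sublinear sp coneC Cp).
have ql := minimal_sublinear_linear sq qmin.
exists q; split=> // [x|z c Czc].
  exact: le_trans (qp x) (inf_convolution_le_self sp coneC Cp x).
have := le_trans (qp (- z)) (inf_convolution_opp sp Cp Czc).
have := sublinear_ge z sq; lra.
Qed.

End HahnBanach.

(** * Functionals on a normed space *)

Section DualTools.
Variables (R : realType) (X : normedModType R).
Implicit Types (f g : dual X) (x : X).

Lemma dualDE f g x : (f + g) x = f x + g x. Proof. by []. Qed.
Lemma dualNE f x : (- f) x = - f x. Proof. by []. Qed.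
Lemma dualBE f g x : (f - g) x = f x - g x. Proof. by []. Qed.
Lemma dualZE (a : R) f x : (a *: f) x = a * f x. Proof. by []. Qed.

Lemma dual_ext f g : (forall x, f x = g x) -> f = g.
Proof. by move=> fg; apply/val_inj/funext. Qed.

Lemma dual_add f x y : f (x + y) = f x + f y.
Proof. exact: linearD. Qed.

Lemma dual_sub f x y : f (x - y) = f x - f y.
Proof. exact: linearB. Qed.

Lemma dual_scale f (a : R) x : f (a *: x) = a * f x.
Proof. exact: linearZ. Qed.

Lemma dual_le f x : f x <= `|f| * `|x| :> R.
Proof. exact: le_trans (ler_norm _) (dual_norm_le f x). Qed.

Lemma dual_le_ball f x (M : R) : `|f| <= M -> `|x| <= 1 -> f x <= M :> R.
Proof.
move=> fM x1; rewrite (le_trans (dual_le f x))// (le_trans _ fM)//.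
by rewrite ler_piMr.
Qed.

(** One-sided bounds suffice, because a functional is odd. *)
Lemma dual_norm_leP f (M : R) : 0 <= M -> (forall x, f x <= M * `|x| :> R) ->
  `|f| <= M.
Proof.
move=> M0 fM; apply: opnorm_leP => // x; rewrite ler_norml fM andbT.
by have := fM (- x); rewrite linearN normrN lerNl.
Qed.

Lemma dual_of_linear (g : X -> R^o) (M : R) : 0 <= M -> linear g ->
  (forall x, g x <= M * `|x| :> R) ->
  exists2 f : dual X, (forall x, f x = g x) & `|f| <= M.
Proof.
move=> M0 gl gM; pose L := GRing.isLinear.Build R X R^o *:%R g gl.
pose g' : {linear X -> R^o} := HB.pack g L.
have gc : continuous g.
  apply: (@bounded_continuous _ _ _ g' M) => x; rewrite ler_norml gM andbT.
  by have := gM (- x); rewrite -[g (- x)]/(g' (- x)) linearN normrN lerNl.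
have gD : g \in @dual_pred R X by apply/asboolP.
by exists (Dual gD) => //; apply: dual_norm_leP.
Qed.

Lemma norm_lt_witness f (r : R) : r < `|f| ->
  exists x, `|x| <= 1 /\ r < f x.
Proof.
move=> /sup_gt[]; first by exists `|f 0|, 0 => //; split=> //=; rewrite normr0.
move=> _ [x [_ /= x1] <-]; have [fx0|fx0] := leP 0 (f x : R).
  by rewrite ger0_norm// => rf; exists x.
rewrite ltr0_norm// => rf; exists (- x).
by rewrite normrN linearN.
Qed.

Lemma norm_sublinear (M : R) : 0 <= M -> sublinear (fun x : X => M * `|x|).
Proof.
move=> M0; split=> [x y|t x t0]; first by rewrite -mulrDr ler_wpM2l// ler_normD.
by rewrite normrZ ger0_norm// mulrCA.
Qed.

Lemma functional_above_cone (C : X -> R -> Prop) (M : R) : 0 <= M ->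
  convex_cone C -> (forall z c, C z c -> c <= M * `|z|) ->
  exists2 f : dual X, `|f| <= M & forall z c, C z c -> c <= f z :> R.
Proof.
move=> M0 coneC CM.
have [g [gl gN gC]] := Hahn_Banach_cone (norm_sublinear M0) coneC CM.
have [f fg fM] := dual_of_linear M0 gl gN.
by exists f => // z c /gC; rewrite fg.
Qed.

(** The cone is the ray of the pairs [(t *: x, t * `|x|)]. *)
Lemma norming_functional x : exists f, `|f| <= 1 /\ f x = `|x|.
Proof.
have [|f f1 fC] := functional_above_cone ler01 (convex_cone_ray x `|x|).
  by move=> _ _ [t [t0 -> ->]]; rewrite mul1r normrZ ger0_norm.
exists f; split=> //; apply/eqP; rewrite eq_le.
rewrite (le_trans (dual_le f x)) ?ler_piMl//= fC//.
by exists 1; rewrite ler01 scale1r mul1r.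
Qed.

Lemma norming_functional_norm x f :
  x != 0 -> `|f| <= 1 -> f x = `|x| -> `|f| = 1.
Proof.
move=> x0 f1 fx; apply/eqP; rewrite eq_le f1/=.
by have := dual_le f x; rewrite fx ler_pMl ?normr_gt0.
Qed.

Lemma csub0 (Z : closedSubspace X) : csub_set Z 0.
Proof. exact/set_mem/(csub_submod Z).1. Qed.

Lemma csub_linear (Z : closedSubspace X) (a : R) x y :
  csub_set Z x -> csub_set Z y -> csub_set Z (a *: x + y).
Proof.
by move=> /mem_set Zx /mem_set Zy; apply/set_mem/(csub_submod Z).2.
Qed.

Lemma csub_scale (Z : closedSubspace X) (a : R) x :
  csub_set Z x -> csub_set Z (a *: x).
Proof. by move=> Zx; rewrite -[_ *: _]addr0; apply/csub_linear/csub0. Qed.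

(** The cone is the graph of [f] on [Z]; as [Z] is symmetric, the lower bounds
on [g] there are equalities. *)
Lemma extension_from_subspace (Z : closedSubspace X) f (M : R) : 0 <= M ->
  (forall z, csub_set Z z -> f z <= M * `|z| :> R) ->
  exists2 g : dual X, (forall z, csub_set Z z -> g z = f z) & `|g| <= M.
Proof.
move=> M0 fM.
have coneC : convex_cone (fun z c => csub_set Z z /\ c = f z).
  split; first by rewrite linear0; split=> //; exact: csub0.
    move=> x y _ _ [Zx ->] [Zy ->]; rewrite linearD; split=> //.
    by rewrite -[x]scale1r; apply: csub_linear.
  by move=> t x _ t0 [Zx ->]; rewrite linearZ; split=> //; exact: csub_scale.
have [|g gM gC] := functional_above_cone M0 coneC.
  by move=> z _ [Zz ->]; apply: fM.
exists g => // z Zz; apply/eqP.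
rewrite eq_le; apply/andP; split; last exact: gC.
rewrite -lerN2 -!linearN gC//; split=> //.
by rewrite -scaleN1r; exact: csub_scale.
Qed.

End DualTools.

(** * The Daugavet property in terms of the dual *)

Section DaugavetDual.
Variables (R : realType) (W : completeNormedModType R).
Implicit Types (f v e : dual W) (w y : W).

Definition tensor f w : W -> W := fun x => (f x : R) *: w.

Lemma tensor_linear f w : linear (tensor f w).
Proof. by move=> a x y; rewrite /tensor linearP scalerDl scalerA. Qed.

HB.instance Definition _ f w :=
  GRing.isLinear.Build R W W *:%R (tensor f w) (@tensor_linear f w).

Lemma tensor_bound f w x : `|tensor f w x| <= (`|f| * `|w|) * `|x|.
Proof. by rewrite normrZ mulrAC ler_wpM2r// dual_norm_le. Qed.

Lemma tensor_continuous f w : continuous (tensor f w).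
Proof. exact: (bounded_continuous (@tensor_bound f w)). Qed.

Lemma tensor_rank_one f w : f != 0 -> w != 0 -> rank_one (tensor f w).
Proof.
move=> f0 w0; exists w => //; apply/seteqP; split=> [_ [x _ <-]|_ [a _ <-]].
  by exists (f x).
have [x fx0] : exists x, (f x : R) != 0.
  apply: contrapT => fN; move/eqP: f0; apply; apply/val_inj/funext => x.
  by apply/eqP/negP => /negP fx; apply: fN; exists x.
by exists ((a / f x) *: x) => //; rewrite /tensor dual_scale divfK.
Qed.

Lemma opnorm_tensor f w : `|f| * `|w| <= opnorm (tensor f w).
Proof.
have [->|w0] := eqVneq w 0; first by rewrite normr0 mulr0 opnorm_ge0.
rewrite -ler_pdivlMr ?normr_gt0//; apply: opnorm_leP => [|x].
  by rewrite divr_ge0// opnorm_ge0.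
rewrite mulrAC ler_pdivlMr ?normr_gt0// -normrZ.
exact: (opnorm_le x (@tensor_continuous f w)).
Qed.

(** If [x] in the ball nearly attains the norm of the identity plus [f] tensor
[y] and [v] norms the image of [x], then [v x], [f x] and [v y] must all be
nearly maximal; the first two bound [`|f + v|] from below.  Working with [f]
and [y] of arbitrary norm spares the iteration a normalisation at each step;
[f] is nonzero because on the zero space there is no [v] of norm near 1. *)
Lemma Daugavet_dual f y (eps : R) : Daugavet W -> f != 0 -> 0 < eps ->
  exists v, [/\ `|v| <= 1, `|y| - eps < v y & `|f| + 1 - eps < `|f + v|].
Proof.
move=> DW f0 eps0; wlog y0 : y / y != 0.
  (* At [y = 0] nothing is asked of [v]: any nonzero vector may replace [y]. *)
  move=> main; have [y0|] := eqVneq y 0; last exact: main.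
  have [x x0] : exists x : W, x != 0.
    apply: contrapT => W0; move/eqP: f0; apply; apply/val_inj/funext => x.
    have -> : x = 0 by apply: contrapT => /eqP x0; apply: W0; exists x.
    exact: (linear0 f).
  have [v [v1 _ fv]] := main x x0; exists v; split=> //.
  by rewrite y0 normr0 linear0 sub0r oppr_lt0.
have nf0 : 0 < `|f| by rewrite normr_gt0.
have ny0 : 0 < `|y| by rewrite normr_gt0.
(* The second bound serves [v y], the first and third serve [`|f + v|], and the
   fourth makes [v y] positive. *)
pose d := Num.min (eps / 2) (Num.min (eps * `|f|)
  (Num.min (eps / 2 * `|y|) (`|f| * `|y|))).
have d0 : 0 < d by rewrite !lt_min !mulr_gt0 ?invr_gt0.
have := DW (tensor f y) (@tensor_continuous f y) (tensor_rank_one f0 y0).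
have := opnorm_tensor f y => Tge TE.
have /sup_gt[] : 1 + `|f| * `|y| - d < opnorm (idfun \+ tensor f y) by lra.
  by exists `|(idfun \+ tensor f y) 0|, 0 => //; split=> //=; rewrite normr0.
move=> _ [x0 [_ /= x01] <-] H.
(* The norm being even, [x0] may be replaced by its opposite. *)
have {H} [x [x1 fx0 H]] : exists x, [/\ `|x| <= 1, 0 <= f x :> R &
    1 + `|f| * `|y| - d < `|x + tensor f y x|].
  have [fx0|fx0] := leP 0 (f x0 : R); first by exists x0.
  exists (- x0); split; first by rewrite normrN.
    by rewrite linearN oppr_ge0 ltW.
  by rewrite linearN -opprD normrN.
have [v [v1 vE]] := norming_functional (x + tensor f y x).
exists v.
move: H; rewrite -vE dual_add /tensor dual_scale => H.
have vx : v x <= 1 :> R by apply: dual_le_ball.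
have fx : f x <= `|f| :> R by apply: dual_le_ball.
have vy : v y <= `|y| :> R.
  by rewrite (le_trans (dual_le v y))// ler_piMl.
have fvx : f x + v x <= `|f + v| :> R.
  by rewrite -dualDE; apply: dual_le_ball.
have fxvy1 : f x * v y <= f x * `|y| by rewrite ler_wpM2l.
have fxy : f x * `|y| <= `|f| * `|y| by rewrite ler_wpM2r.
have de1 : d <= eps / 2 by rewrite ge_min lexx.
have de2 : d <= eps * `|f| by rewrite !ge_min lexx orbT.
have de3 : d <= eps / 2 * `|y| by rewrite !ge_min lexx !orbT.
have de4 : d <= `|f| * `|y| by rewrite !ge_min lexx !orbT.
split=> //.
- have [vy0|vy0] := leP (v y : R) 0.
    have fvy0 : f x * v y <= 0 by rewrite mulr_ge0_le0.
    lra.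
- have fvy : f x * v y <= `|f| * v y by rewrite ler_wpM2r// ltW.
  have : `|f| * (`|y| - eps) < `|f| * v y by rewrite mulrBr (mulrC _ eps); lra.
  by rewrite ltr_pM2l.
- have : `|y| * (`|f| - eps / 2) < `|y| * f x.
    by rewrite mulrBr (mulrC `|y|) (mulrC _ (eps / 2)) (mulrC `|y| (f x)); lra.
  by rewrite ltr_pM2l// => ?; lra.
Qed.

(** Write [T] as [f] tensor [w] with [`|w| = 1].  If [v w] is close to 1 and
[v] and [f / `|f|] are nearly maximal at the same [x], then [v] evaluated at
[x + f x *: w] is close to [1 + `|f|]. *)
Lemma Daugavet_of_dual :
  (forall f w (eps : R), `|f| = 1 -> `|w| = 1 -> 0 < eps ->
    exists v, [/\ `|v| <= 1, 1 - eps < v w & 2 - eps < `|f + v|]) ->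
  Daugavet W.
Proof.
move=> dualW T Tc [w0 w0n0 TE].
have nw0 : 0 < `|w0| by rewrite normr_gt0.
pose w := `|w0|^-1 *: w0.
have nw : `|w| = 1.
  by rewrite normrZ ger0_norm ?invr_ge0// mulVf ?gt_eqF.
have [h [h1 hw0]] := norming_functional w0.
have [f fE _] : exists2 f : dual W,
    (forall x, f x = h (T x)) & `|f| <= opnorm T.
  apply: (@dual_of_linear _ _ (h \o T)); first exact: opnorm_ge0.
    by move=> a x y /=; rewrite !linearP.
  move=> x /=; rewrite (le_trans (dual_le _ _))//.
  by rewrite (le_trans (ler_piMl _ _))// opnorm_le.
have Tf x : T x = (f x : R) *: w.
  have [a _ Tx] : [set a *: w0 | a in setT] (T x) by rewrite -TE; exists x.
  rewrite fE -Tx dual_scale hw0 scalerA.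
  by rewrite mulfK ?gt_eqF.
have f0 : f != 0.
  apply/eqP => f0; move/eqP: w0n0; apply.
  have [x _ <-] : range T w0 by rewrite TE; exists 1; rewrite ?scale1r.
  by rewrite Tf f0 scale0r.
have t0 : 0 < `|f| by rewrite normr_gt0.
have opT : opnorm T <= `|f|.
  by apply: opnorm_leP => // x; rewrite Tf normrZ nw mulr1 dual_norm_le.
have idTc : continuous (idfun \+ T).
  by move=> x; apply: cvgD; [exact: cvg_id|exact: Tc].
apply/eqP; rewrite eq_le; apply/andP; split.
  apply: opnorm_leP; first by rewrite addr_ge0// opnorm_ge0.
  move=> x; rewrite (le_trans (ler_normD _ _))// mulrDl mul1r lerD2l.
  exact: opnorm_le.
rewrite (@le_trans _ _ (1 + `|f|)) ?lerD2l//.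
apply/ler_addgt0Pr => eps eps0.
pose d := Num.min 1 (eps / (2 * (1 + `|f|))).
have f1 : 0 < 1 + `|f| by rewrite addr_gt0.
have d0 : 0 < d by rewrite lt_min ltr01 divr_gt0// mulr_gt0.
have d1 : d <= 1 by rewrite ge_min lexx.
have de : d * (2 * (1 + `|f|)) <= eps.
  by rewrite -ler_pdivlMr ?mulr_gt0// ge_min lexx orbT.
have nfn : `|(`|f|^-1 *: f)| = 1.
  by rewrite normrZ ger0_norm ?invr_ge0// mulVf ?gt_eqF.
have [v [v1 vw fv]] := dualW (`|f|^-1 *: f) w d nfn nw d0.
have [x [x1]] := norm_lt_witness fv; rewrite dualDE dualZE => fvx.
have vx : v x <= 1 :> R by apply: dual_le_ball.
have fx1 : (`|f|^-1 * f x) <= 1 :> R.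
  by rewrite ler_pdivrMl// mulr1; apply: dual_le_ball.
have fx : `|f| * (1 - d) <= f x :> R by rewrite -ler_pdivlMl//; lra.
have : `|(idfun \+ T) x| <= opnorm (idfun \+ T).
  by rewrite (le_trans (opnorm_le _ idTc))// ler_piMr// opnorm_ge0.
have : v x + f x * v w <= `|(idfun \+ T) x| :> R.
  rewrite /= Tf -[X in X <= _]/(v x + (f x : R) *: v w) -linearZ -linearD.
  by rewrite (le_trans (dual_le _ _))// ler_piMl.
have : `|f| * (1 - d) * (1 - d) <= f x * v w.
  rewrite ler_pM//; last exact: ltW.
    by rewrite mulr_ge0// subr_ge0.
  by rewrite subr_ge0.
have : 0 <= `|f| * (d * d) by rewrite !mulr_ge0// ltW.
nra.
Qed.

End DaugavetDual.

(** * Weak-star approximation by averaging *)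

Section Approachability.
Variables (R : realType) (W : completeNormedModType R).
Hypothesis DW : Daugavet W.
Variables (f e : dual W) (n : nat) (u : 'I_n -> W).
Hypotheses (f1 : `|f| = 1) (e1 : `|e| <= 1).

(** A bound for the growth, in one step, of the squared length of the error
vector: the new error at [u i] is at most [2 * `|u i|], and 1 absorbs the slack
in the choice of the slice. *)
Let K : R := 1 + \sum_(i < n) 4 * `|u i| ^+ 2.

(** Think of [s] as a sum [v_1 + ... + v_m] with [v_i] in the dual ball and of
[D i = s (u i) - m%:R * e (u i)] as its accumulated error.  The next [v] is
taken in the slice given by [y = - \sum_i D i *: u i]: as [e] is in the ball,
[v y] cannot be much less than [e y], which says that the new error has an
almost nonpositive inner product with [D]. *)
Lemma approachability (m : nat) (eta : R) : 0 < eta -> eta < 1 ->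
  exists s : dual W, [/\ `|s| <= m%:R, 1 + m%:R - eta < `|f + s| &
    \sum_(i < n) (s (u i) - m%:R * e (u i)) ^+ 2 <= m%:R * K].
Proof.
elim: m eta => [|m IH] eta eta0 eta1.
  exists 0; rewrite normr0 [f + 0]addr0 f1 addr0 mul0r; split=> //; first lra.
  by rewrite big1// => i _; rewrite mul0r subr0 expr0n.
have [||s [sm fs sK]] := IH (eta / 2); [lra|lra|].
pose D i : R := s (u i) - m%:R * e (u i).
pose y := - \sum_(i < n) D i *: u i.
have gy (g : dual W) : g y = - \sum_(i < n) D i * g (u i) :> R.
  rewrite linearN linear_sum; congr (- _); apply: eq_bigr => i _.
  exact: dual_scale.
have fs0 : f + s != 0.
  by rewrite -normr_gt0 (le_lt_trans _ fs)//; have := ler0n R m; lra.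
have eta20 : 0 < eta / 2 by lra.
have [v [v1 vy fsv]] := Daugavet_dual y DW fs0 eta20.
exists (s + v); rewrite -natr1; split.
- by rewrite (le_trans (ler_normD _ _))// lerD.
- by rewrite [f + _]addrA; lra.
pose d i : R := v (u i) - e (u i).
have Dd : \sum_(i < n) D i * d i <= eta / 2.
  have ey : e y <= `|y| :> R by rewrite (le_trans (dual_le e y))// ler_piMl.
  have -> : \sum_(i < n) D i * d i = e y - v y.
    rewrite !gy opprK addrC -sumrB; apply: eq_bigr => i _.
    by rewrite mulrBr.
  lra.
have dK : \sum_(i < n) d i ^+ 2 <= \sum_(i < n) 4 * `|u i| ^+ 2.
  apply: ler_sum => i _; rewrite (_ : 4 = 2 ^+ 2 :> R); last by rewrite -natrX.
  rewrite -exprMn.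
  rewrite -[X in X <= _](@ger0_norm _ (d i ^+ 2)) ?sqr_ge0// normrX.
  rewrite ler_sqr ?nnegrE ?mulr_ge0//.
  rewrite (le_trans (ler_normB _ _))// mulrDl mul1r.
  rewrite lerD// (le_trans (dual_norm_le _ _))// ler_piMl//.
rewrite mulrDl mul1r /K.
rewrite (eq_bigr (fun i => D i ^+ 2 + 2 * (D i * d i) + d i ^+ 2)); last first.
  move=> i _; rewrite dualDE /D /d; lra.
rewrite !big_split/= -mulr_sumr; rewrite /D in Dd *; rewrite /K in sK.
lra.
Qed.

(** The mean [v] of the [m] functionals has errors of order [1 / sqrt m]; since
[s = m *: v], the triangle inequality turns the lower bound on [`|f + s|] into
one on [`|f + v|]. *)
Lemma Daugavet_weak_star_approximation (eps : R) : 0 < eps ->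
  exists v : dual W, [/\ `|v| <= 1, 2 - eps < `|f + v| &
    forall i, `|v (u i) - e (u i)| < eps].
Proof.
move=> eps0; pose eta := Num.min eps 2^-1.
have eta0 : 0 < eta by rewrite lt_min eps0/= invr_gt0 ltr0n.
have eta1 : eta < 1 by rewrite gt_min invf_lt1// ltr1n orbT.
have etae : eta <= eps by rewrite ge_min lexx.
pose m := (Num.trunc (K / eps ^+ 2)).+1.
have Km : K < m%:R * eps ^+ 2.
  by rewrite -ltr_pdivrMr ?exprn_gt0// truncnS_gt.
have m0 : 0 < m%:R :> R by rewrite ltr0n.
have [s [sm fs sK]] := approachability m eta0 eta1.
pose v := m%:R^-1 *: s.
have nv : `|v| <= 1.
  by rewrite normrZ ger0_norm ?invr_ge0// ler_pdivrMl// mulr1.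
exists v; split=> //.
  have -> : f + v = (f + s) - (m%:R - 1) *: v.
    rewrite scalerBl scale1r scalerA mulfV ?gt_eqF// scale1r.
    by rewrite opprB addrA addrAC addrK.
  rewrite (lt_le_trans _ (lerB_dist _ _))// normrZ ger0_norm ?subr_ge0 ?ler1n//.
  have : (m%:R - 1) * `|v| <= (m%:R - 1) * 1.
    by rewrite ler_wpM2l// subr_ge0 ler1n.
  lra.
move=> i; rewrite -ltr_sqr ?nnegrE ?(ltW eps0)//.
rewrite real_normK ?num_real//.
have -> : (v (u i) - e (u i)) = m%:R^-1 * (s (u i) - m%:R * e (u i)).
  by rewrite dualZE mulrBr mulKf// gt_eqF.
rewrite exprMn exprVn mulrC ltr_pdivrMr ?exprn_gt0//.
apply: (@le_lt_trans _ _ (m%:R * K)).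
  apply: le_trans sK; rewrite (bigD1 i)//= lerDl sumr_ge0// => j _.
  exact: sqr_ge0.
by rewrite expr2 mulrCA ltr_pM2l// mulrC.
Qed.

End Approachability.

(** * Subspaces, quotients and their duals *)

Section SubspaceDuality.
Variables (R : realType) (X : normedModType R).
Implicit Types (Z : closedSubspace X) (f g : dual X).

Lemma kernel_in_submod Z f :
  submod_closed (mem [set z | csub_set Z z /\ f z = 0]).
Proof.
split; first by apply/mem_set; split; [exact: csub0|rewrite linear0].
move=> a x y /set_mem[Zx fx] /set_mem[Zy fy]; apply/mem_set; split.
  exact: csub_linear.
by rewrite dual_add dual_scale fx fy mulr0 addr0.
Qed.

Lemma kernel_in_closed Z f : closed [set z | csub_set Z z /\ f z = 0].
Proof.
apply: closedI; first exact: csub_closed.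
apply: (@closed_comp _ _ f [set 0]) => [x _|]; first exact: dual_continuous.
exact: closed_eq.
Qed.

Definition kernel_in Z f : closedSubspace X :=
  ClosedSubspace (@kernel_in_submod Z f) (@kernel_in_closed Z f).

(** Taking [f z] itself as the coefficient of [u] keeps it bounded in [z]; [u]
is scaled to [f u = 1], and it is 0 if [f] vanishes on [Z]. *)
Lemma kernel_in_complement Z f : exists u, csub_set Z u /\
  forall z, csub_set Z z -> csub_set (kernel_in Z f) (z - f z *: u).
Proof.
have [[u [Zu fu]]|fZ] := pselect (exists u, csub_set Z u /\ (f u : R) != 0).
  exists ((f u)^-1 *: u); split; first exact: csub_scale.
  move=> z Zz; rewrite scalerA -scaleNr addrC; split; first exact: csub_linear.
  by rewrite dual_add dual_scale mulNr divfK// addNr.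
exists 0; split=> [|z Zz]; first exact: csub0.
rewrite scaler0 subr0; split=> //.
by apply/eqP/negP => /negP fz; apply: fZ; exists z.
Qed.

Lemma dual_quotient_eq0 Z (g : dual (quotient_space Z)) z :
  csub_set Z z -> g (quotient_map Z z) = 0.
Proof.
move=> Zz; have -> : quotient_map Z z = 0; last exact: linear0.
by rewrite -(linear0 (quotient_map Z)); apply/quotient_map_eq; rewrite subr0.
Qed.

Lemma dual_pullback Z (g : dual (quotient_space Z)) :
  exists2 f : dual X, (forall x, f x = g (quotient_map Z x)) & `|f| <= `|g|.
Proof.
apply: (@dual_of_linear _ _ (g \o quotient_map Z)) => //.
  by move=> a x y /=; rewrite !linearP.
move=> x /=; rewrite (le_trans (dual_le _ _))// ler_wpM2l//.
exact: quotient_norm_le.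
Qed.

Lemma dual_lift Z f : (forall z, csub_set Z z -> f z = 0) ->
  exists2 g : dual (quotient_space Z),
    (forall x, g (quotient_map Z x) = f x) & `|g| = `|f|.
Proof.
move=> fZ; pose h (w : quotient_space Z) : R^o := f (repr w).
have hE x : h (quotient_map Z x) = f x.
  apply/eqP; rewrite -subr_eq0 -[_ - _](linearB f); apply/eqP/fZ.
  exact/quotient_map_eq/quotient_mapK.
have hl : linear h.
  move=> a v w; rewrite -(quotient_mapK v) -(quotient_mapK w).
  by rewrite -linearP !hE linearP.
have hf w : h w <= `|f| * `|w| :> R.
  have [f0|f0] := eqVneq f 0; first by rewrite /h f0 normr0 mul0r.
  rewrite -ler_pdivrMl ?normr_gt0//; apply: lb_le_inf.
    exact: (quotient_norm_has_inf w).1.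
  move=> _ [x <- <-]; rewrite hE ler_pdivrMl ?normr_gt0//.
  exact: dual_le.
have [g gh gf] := dual_of_linear (normr_ge0 f) hl hf.
exists g => [x|]; first by rewrite gh hE.
apply/eqP; rewrite eq_le gf; apply: dual_norm_leP => // x.
rewrite -hE -gh (le_trans (dual_le _ _))// ler_wpM2l//.
exact: quotient_norm_le.
Qed.

Lemma dual_pullback_norm Z (g : dual (quotient_space Z)) :
  exists2 f : dual X, (forall x, f x = g (quotient_map Z x)) & `|f| = `|g|.
Proof.
have [f fg _] := dual_pullback g; exists f => //.
have [z Zz|h hf <-] := @dual_lift Z f; first by rewrite fg dual_quotient_eq0.
congr `|_|; apply: dual_ext => w; rewrite -(quotient_mapK w) hf.
exact: fg.
Qed.

Lemma opnorm_on_le Z f z : csub_set Z z -> `|f z| <= opnorm_on Z f * `|z|.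
Proof.
move=> Zz; have [->|z0] := eqVneq z 0.
  by rewrite linear0 !normr0 mulr0.
have nz0 : 0 < `|z| by rewrite normr_gt0.
rewrite -ler_pdivrMr// -[X in _ / X]normr_id -normf_div mulrC -dual_scale.
apply: sup_upper_bound.
  split.
    by exists `|f 0|, 0 => //; split; [apply: csub0|rewrite /= normr0].
  exists `|f| => _ [x [_ /= x1] <-].
  by rewrite (le_trans (dual_norm_le _ _))// ler_piMr.
exists (`|z|^-1 *: z) => //; split; first exact: csub_scale.
by rewrite /= normrZ ger0_norm ?invr_ge0// mulVf ?gt_eqF.
Qed.

(** All members of the class of [f] agree with [f] on [Z], so the norm of each
of them bounds the supremum. *)
Lemma opnorm_on_le_annihilator Z f :
  opnorm_on Z f <= `|quotient_map (annihilator Z) f|.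
Proof.
apply: ge_sup.
  by exists `|f 0|, 0 => //; split; [apply: csub0|rewrite /= normr0].
move=> _ [z [Zz /= z1] <-]; apply: lb_le_inf.
  exact: (quotient_norm_has_inf _).1.
move=> _ [g /quotient_map_eq gf <-].
have -> : f z = g z.
  by apply/eqP; rewrite eq_sym -subr_eq0 -dualBE; apply/eqP/gf.
by rewrite (le_trans (dual_norm_le _ _))// ler_piMr.
Qed.

Lemma canonical_embedding_norm (x : X) : `|canonical_embedding x| = `|x|.
Proof.
apply/eqP; rewrite eq_le; apply/andP; split.
  by apply: dual_norm_leP => // g; rewrite mulrC; exact: (dual_le g x).
have [g [g1 <-]] := norming_functional x.
by rewrite (le_trans (dual_le (canonical_embedding x) g))// ler_piMr.
Qed.

End SubspaceDuality.

(** * Poor subspaces and rich annihilators *)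

Section PoorRich.
Variables (R : realType) (X : completeNormedModType R).
Implicit Types (Z : closedSubspace X).

(** With [Z2] the common kernel of [x'] and [e'] in [Z], two vectors [u1] and
[u2] span [Z] modulo [Z2], with coefficients that are combinations of [x'] and
[e'].  Hence [v - e'], which vanishes on [Z2], agrees on [Z] with an explicit
combination [h] of [x'] and [e'] whose coefficients are small as soon as
[v - e'] is small at [u1] and [u2]; [h] bounds the distance of the classes. *)
Lemma rich_annihilator Z :
  (forall Z' : closedSubspace X, Z' `<=` Z -> codim_le Z' Z 2 ->
    Daugavet (quotient_space Z')) ->
  rich (range (@canonical_embedding R X)) (annihilator Z).
Proof.
move=> DZ; split; first exact: quotient_map_continuous.
move=> x' e' eps _ delta x'1 e'1 eps0 [x _ <-] _ delta0 [_ /= e'x].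
have [u1 [Zu1 u1P]] := kernel_in_complement Z x'.
set Z1 := kernel_in Z x' in u1P.
have [u2 [Zu2 u2P]] := kernel_in_complement Z1 e'.
set Z2 := kernel_in Z1 e' in u2P.
pose b z : R := e' (z - (x' z : R) *: u1).
have decomp z : csub_set Z z ->
    csub_set Z2 (z - (x' z : R) *: u1 - b z *: u2).
  by move=> Zz; apply/u2P/u1P.
have DW : Daugavet (quotient_space Z2).
  apply: DZ => [z [[]]//|].
  exists (fun i => if i == ord0 then u1 else u2); split.
    by move=> i; case: ifP => // _; exact: Zu2.1.
  move=> z Zz; exists (fun i => if i == ord0 then x' z else b z).
  rewrite !big_ord_recl big_ord0 addr0 /= opprD addrA.
  exact: decomp.
have [f fx f1] : exists2 f : dual (quotient_space Z2),
    (forall y, f (quotient_map Z2 y) = x' y) & `|f| = `|x'|.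
  by apply: dual_lift => z [[]].
have [e ee e1] : exists2 e : dual (quotient_space Z2),
    (forall y, e (quotient_map Z2 y) = e' y) & `|e| = `|e'|.
  by apply: dual_lift => z [].
rewrite x'1 in f1; rewrite e'1 in e1.
pose c := `|e' u1 : R|.
(* The first bound keeps [v] in the slice; the second one serves the estimate
   [`|h| <= d * (2 + c)] below. *)
pose d := Num.min (e' x - (1 - delta)) (eps / (3 + c)).
have c0 : 0 <= c by exact: normr_ge0.
have d0 : 0 < d by rewrite lt_min subr_gt0 e'x divr_gt0//; lra.
have dx : d <= e' x - (1 - delta) by rewrite ge_min lexx.
have deps : d * (3 + c) <= eps.
  by rewrite -ler_pdivlMr ?ge_min ?lexx ?orbT//; lra.
have m0 : 0 < Num.min d eps by rewrite lt_min d0.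
have e1' : `|e| <= 1 by rewrite e1.
have [w [w1 fw we]] := Daugavet_weak_star_approximation DW
  (fun i : 'I_3 => quotient_map Z2 (nth 0 [:: u1; u2; x] i)) f1 e1' m0.
have [v vw vn] := dual_pullback_norm w.
have close y : y \in [:: u1; u2; x] -> `|v y - e' y| < d.
  move=> yu; have := yu; rewrite -index_mem => yi.
  have := we (Ordinal yi); rewrite /= nth_index// ee -vw => /lt_le_trans; apply.
  by rewrite ge_min lexx.
have [] : [/\ `|v u1 - e' u1| < d, `|v u2 - e' u2| < d & `|v x - e' x| < d].
  by split; apply: close; rewrite !inE eqxx ?orbT.
move=> vu1 vu2 vx; exists v; split.
- split; first by rewrite vn.
  suff : 1 - delta < v x :> R by [].
  by move: vx; rewrite ltr_distlC => /andP[_]; lra.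
- apply: (@le_lt_trans _ _ (2 - Num.min d eps)).
    by rewrite lerD2l lerN2 ge_min lexx orbT.
  have [xv xvw nxv] := dual_pullback_norm (f + w).
  have -> : x' + v = xv by apply: dual_ext => y; rewrite xvw !dualDE fx vw.
  by rewrite nxv.
pose h := (v u1 - e' u1 : R) *: x' +
  (v u2 - e' u2 : R) *: (e' - (e' u1 : R) *: x').
have vh : quotient_map (annihilator Z) v - quotient_map (annihilator Z) e' =
    quotient_map (annihilator Z) h.
  rewrite -linearB; apply/quotient_map_eq => z Zz.
  have [[Z2z x'z] e'z] := decomp z Zz.
  have vz : v (z - (x' z : R) *: u1 - b z *: u2) = 0.
    by rewrite vw dual_quotient_eq0//; exact: decomp.
  move: vz e'z; rewrite /h /b !(dualDE, dualNE, dualZE).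
  rewrite !dual_sub !dual_scale => vz e'z.
  nra.
rewrite vh (le_lt_trans (quotient_norm_le _ _))//.
rewrite (le_lt_trans (ler_normD _ _))// !normrZ x'1 mulr1.
have h1 : `|e' - (e' u1 : R) *: x'| <= 1 + c.
  by rewrite (le_trans (ler_normB _ _))// normrZ e'1 x'1 mulr1.
have : `|v u2 - e' u2| * `|e' - (e' u1 : R) *: x'| <= d * (1 + c).
  by rewrite ler_pM// ltW.
nra.
Qed.

(** Richness with the same number as size of the slice and as tolerance. *)
Lemma rich_annihilator_restriction Z :
  rich (range (@canonical_embedding R X)) (annihilator Z) ->
  forall (x' e' : dual X) (eps : R) (x : X),
    `|x'| = 1 -> `|e'| = 1 -> 0 < eps -> `|x| = 1 -> 1 - eps < e' x ->
    exists v' : dual X,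
      [/\ `|v'| <= 1, 1 - eps < v' x, 2 - eps < `|x' + v'| &
          opnorm_on Z (e' - v') < eps].
Proof.
move=> [_ richZ] x' e' eps x x'1 e'1 eps0 x1 e'x.
have [|||v [[v1 vx] x'v ve]] :=
  richZ x' e' eps (canonical_embedding x) eps x'1 e'1 eps0 _ _ eps0.
- by exists x.
- by rewrite canonical_embedding_norm.
- by split; rewrite ?e'1.
exists v; split=> //; apply: le_lt_trans (opnorm_on_le_annihilator _ _) _.
by rewrite linearB distrC.
Qed.

(** Apply the hypothesis to the pullbacks of [f] and of a functional [h]
norming [w], at a nearly minimal representative [x] of [w].  The resulting [v]
is at most [d] on the ball of [Z'], so it becomes a functional on the quotient
after subtracting some [g] of norm at most [d]; dividing by [1 + d] brings it
back to the unit ball.  Every loss is of order [d], and three of them add up to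
at most [eps]. *)
Lemma Daugavet_quotient Z (Z' : closedSubspace X) :
  (forall (x' e' : dual X) (eps : R) (x : X),
    `|x'| = 1 -> `|e'| = 1 -> 0 < eps -> `|x| = 1 -> 1 - eps < e' x ->
    exists v' : dual X,
      [/\ `|v'| <= 1, 1 - eps < v' x, 2 - eps < `|x' + v'| &
          opnorm_on Z (e' - v') < eps]) ->
  Z' `<=` Z -> Daugavet (quotient_space Z').
Proof.
move=> narrowZ Z'Z; apply: Daugavet_of_dual => f w eps f1 w1 eps0.
pose d := Num.min 1 (eps / 3).
have d0 : 0 < d by rewrite lt_min ltr01 divr_gt0.
have d1 : d <= 1 by rewrite ge_min lexx.
have de : d <= eps / 3 by rewrite ge_min lexx orbT.
have [x xw xd] : exists2 x, quotient_map Z' x = w & `|x| < 1 + d.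
  by apply: quotient_norm_lift; rewrite -quotient_normE w1 ltrDl.
have x1 : 1 <= `|x| by rewrite -w1 -xw; exact: quotient_norm_le.
have x0 : 0 < `|x| by exact: lt_le_trans x1.
have [h [h1 hw]] := norming_functional w.
have nh : `|h| = 1.
  by apply: (norming_functional_norm _ h1 hw); rewrite -normr_gt0 w1.
have [x' x'f nx'] := dual_pullback_norm f.
have [e' e'h ne'] := dual_pullback_norm h.
rewrite f1 in nx'; rewrite nh in ne'.
have nx1 : `| `|x|^-1 *: x| = 1.
  by rewrite normrZ ger0_norm ?invr_ge0// mulVf ?gt_eqF.
have e'x : 1 - d < e' (`|x|^-1 *: x).
  rewrite dual_scale e'h xw hw w1 mulr1 -[X in _ < X]mul1r ltr_pdivlMr//.
  nra.
have [v [v1 vx x'v ve]] := narrowZ _ _ _ _ nx' ne' d0 nx1 e'x.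
have vZ' z : csub_set Z' z -> v z <= d * `|z| :> R.
  move=> Z'z; have e'z : e' z = 0.
    by rewrite e'h dual_quotient_eq0.
  have := opnorm_on_le (e' - v) (Z'Z _ Z'z).
  rewrite dualBE e'z sub0r normrN => /le_trans vz.
  by rewrite (le_trans (ler_norm _))// vz// ler_wpM2r// ltW.
have [g gv gd] := extension_from_subspace (ltW d0) vZ'.
have [z Z'z|k kE nk] := @dual_lift _ _ Z' (v - g).
  by rewrite dualBE gv// subrr.
have k1 : `|k| <= 1 + d.
  by rewrite nk (le_trans (ler_normB _ _))// lerD.
have d10 : 0 < 1 + d by lra.
exists ((1 + d)^-1 *: k); split.
- by rewrite normrZ ger0_norm ?invr_ge0 ?(ltW d10)// ler_pdivrMl// mulr1.
- rewrite dualZE -xw kE dualBE ltr_pdivlMl//.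
  have gx : g x <= d * (1 + d) :> R.
    by rewrite (le_trans (dual_le _ _))// ler_pM// ltW.
  move: vx; rewrite dual_scale ltr_pdivlMl// => vx.
  nra.
have fk : 2 - d - d < `|f + k|.
  have [y [y1]] := norm_lt_witness x'v.
  rewrite dualDE => x'vy.
  have gy : g y <= d :> R by apply: dual_le_ball.
  have := dual_le (f + k) (quotient_map Z' y).
  rewrite dualDE kE dualBE -x'f => fky.
  have : `|f + k| * `|quotient_map Z' y| <= `|f + k|.
    by rewrite ler_piMr// (le_trans (quotient_norm_le _ _)).
  lra.
have -> : (1 + d)^-1 *: k = k - (d / (1 + d)) *: k.
  rewrite -[X in X - _]scale1r -scalerBl; congr (_ *: _).
  by field; rewrite gt_eqF.
rewrite [f + _]addrA (lt_le_trans _ (lerB_dist _ _))//.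
have : `|(d / (1 + d)) *: k| <= d.
  rewrite normrZ ger0_norm ?divr_ge0 ?(ltW d10) ?(ltW d0)//.
  by rewrite mulrAC ler_pdivrMr// ler_wpM2l// ltW.
lra.
Qed.

End PoorRich.

(** * The characterisation *)

Theorem theorem5p8 (R : realType) (X : completeNormedModType R)
    (Z : closedSubspace X) (DX : Daugavet X) :
  [<-> (* (i) *) poor Z;
       (* (ii) *)
       forall Z' : closedSubspace X, Z' `<=` Z -> codim_le Z' Z 2 ->
         Daugavet (quotient_space Z');
       (* (iii) *)
       rich (range (@canonical_embedding R X)) (annihilator Z);
       (* (iv) *)
       forall (x' e' : dual X) (eps : R) (x : X),
         `|x'| = 1 -> `|e'| = 1 -> 0 < eps -> `|x| = 1 -> 1 - eps < e' x ->
         exists v' : dual X,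
           [/\ `|v'| <= 1, 1 - eps < v' x, 2 - eps < `|x' + v'| &
               opnorm_on Z (e' - v') < eps]].
Proof.
tfae.
- by move=> poorZ Z' Z'Z _; exact: poorZ.
- exact: rich_annihilator.
- exact: rich_annihilator_restriction.
- by move=> narrowZ Z' Z'Z; exact: (Daugavet_quotient narrowZ).
Qed.
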